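(* For any formula $\varphi$ such that $\mathsf{FL}^k_{ew}\not\vdash\varphi$, there exists a finite set of $(\cdot,\vee,1)$-canonical formulas $\{\gamma(A_i,D_i^{\wedge},D_i^{\to})\mid 0\le i\le m\}$ such that for any $B\in k\text{-}\mathsf{CIRL}$: $$B\models\varphi\quad\text{if, and only if,}\quad \forall i\le m\ \ B\models\gamma(A_i,D_i^{\wedge},D_i^{\to}).$$
   Context: Here $k$ is a natural number. A commutative residuated lattice is an algebra $\langle A,\cdot,\to,\wedge,\vee,1\rangle$ where $\langle A,\cdot,1\rangle$ is a commutative monoid, $\langle A,\wedge,\vee\rangle$ is a lattice (with order $\le$), and $x\cdot y\le z$ iff $y\le x\to z$. It is bounded if its order has a largest element $\top$ and a least element $\bot$, integral if it is bounded and $\top=1$ (so $x\le 1$ for all $x$), and $k$-potent if $x^{k}=x^{k+1}$ for all $x$. It is pointed if the type is expanded by an additional constant $0$, which may be evaluated arbitrarily. $k\text{-}\mathsf{CIRL}$ denotes the class of $k$-potent, commutative, integral residuated lattices; the constant $0$ may or may not be included in the type (the result is meant for either choice, made in the same way for the algebras and for the formulas). Write $a\leftrightarrow b$ for $(a\to b)\wedge(b\to a)$. An algebra $A$ is subdirectly irreducible if, whenever it embeds into a direct product of algebras in such a way that the compositions of the embedding with the projections are surjective, $A$ is isomorphic to one of the algebras in the product. Formulas are identified with terms in the language of these algebras. For $B\in k\text{-}\mathsf{CIRL}$, $B\models\varphi$ means that $v(\varphi)=1$ for every valuation $v$ into $B$ (homomorphism from the algebra of terms to $B$). $\mathsf{FL}^k_{ew}$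 is the Full Lambek calculus with exchange, weakening and the $k$-potency axiom $\varphi^{k}\leftrightarrow\varphi^{k+1}$; $k\text{-}\mathsf{CIRL}$ is its equivalent algebraic semantics, so $\mathsf{FL}^k_{ew}\vdash\varphi$ iff $B\models\varphi$ for every $B\in k\text{-}\mathsf{CIRL}$. Canonical formulas: let $A\in k\text{-}\mathsf{CIRL}$ be finite and subdirectly irreducible, and let $D^{\wedge},D^{\to}$ be subsets of $A^2$. For each $a\in A$ introduce a new variable $X_a$. Let $\Gamma$ be the meet of the formulas: $X_{\bot}\leftrightarrow\bot$ (where $X_\bot$ is the variable of the least element of $A$ and $\bot$ stands for the least element of the algebra in which the formula is evaluated); $X_{1}\leftrightarrow 1$; $X_{a\cdot b}\leftrightarrow (X_a\cdot X_b)$ and $X_{a\vee b}\leftrightarrow (X_a\vee X_b)$ for all $a,b\in A$; $X_{a\to b}\leftrightarrow (X_a\to X_b)$ for $(a,b)\in D^{\to}$; and $X_{a\wedge b}\leftrightarrow (X_a\wedge X_b)$ for $(a,b)\in D^{\wedge}$. Let $\Delta:=\bigvee\{X_a\to X_b\mid a,b\in A,\ a\not\le b\}$. The $(\cdot,\vee,1)$-canonical formula associated with $A,D^\wedge,D^\to$ is $\gamma(A,D^{\wedge},D^{\to}):=\Gamma^{k}\to\Delta$.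
   Formalization: When the constant 0 is in the type, Γ also includes X_0 ↔ 0; without it the claim fails for φ = 0, as canonical formulas would not mention 0. Without 0 in the type, Γ is as stated. The lattice order is taken to be decidable, which is no restriction classically. *)

(* Defs.v *)
From HB Require Import structures.
From mathcomp Require Import all_boot all_order.

Set Implicit Arguments.
Unset Strict Implicit.
Unset Printing Implicit Defensive.

Local Open Scope group_scope.
Local Open Scope order_scope.

(* The carriers are lattices of the order library, hence choice types with    *)
(* a decidable order; classically this is no restriction.  The boolean [pt]   *)
(* says whether the constant 0 belongs to the type: [zero : pt -> T] is one   *)
(* unconstrained element of T if [pt = true], and no data if [pt = false].    *)
#[key="T"]
HB.mixin Record isCRL (pt : bool) (d : Order.disp_t) T
    of Order.Lattice d T & Monoid T := {
  imp : T -> T -> T;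
  zero : pt -> T;
  mul_comm : forall x y : T, (x * y)%g = (y * x)%g;
  residuation : forall x y z : T, (x * y)%g <= z <-> y <= imp x z
}.

#[short(type="crlType")]
HB.structure Definition CRL (pt : bool) (d : Order.disp_t) :=
  {T of Order.Lattice d T & Monoid T & isCRL pt d T}.

#[key="T"]
HB.mixin Record isIntegral (pt : bool) (d : Order.disp_t) T
    of CRL pt d T & Order.TBLattice d T := {
  top_one : \top = 1%g :> T
}.

#[short(type="cirlType")]
HB.structure Definition CIRL (pt : bool) (d : Order.disp_t) :=
  {T of CRL pt d T & Order.TBLattice d T & isIntegral pt d T}.

#[key="T"]
HB.mixin Record isKPotent (k : nat) (pt : bool) (d : Order.disp_t) T
    of CIRL pt d T := {
  kpotent : forall x : T, (x ^+ k)%g = (x ^+ k.+1)%g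
}.

#[short(type="kcirlType")]
HB.structure Definition KCIRL (k : nat) (pt : bool) (d : Order.disp_t) :=
  {T of CIRL pt d T & isKPotent k pt d T}.

#[short(type="finKcirlType")]
HB.structure Definition FinKCIRL (k : nat) (pt : bool) (d : Order.disp_t) :=
  {T of KCIRL k pt d T & Finite T}.

Record crl_hom (pt : bool) (d : Order.disp_t) (A C : crlType pt d)
    (f : A -> C) : Prop := CrlHom {
  hom_mul  : forall x y : A, f (x * y)%g = (f x * f y)%g;
  hom_imp  : forall x y : A, f (imp x y) = imp (f x) (f y);
  hom_meet : forall x y : A, f (x `&` y) = f x `&` f y;
  hom_join : forall x y : A, f (x `|` y) = f x `|` f y;
  hom_one  : f 1%g = 1%g;
  hom_zero : forall h : pt, f (zero h) = zero h
}.

Definition crl_isomorphic (pt : bool) (d : Order.disp_t)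
    (A C : crlType pt d) : Prop :=
  exists2 g : A -> C, crl_hom g & bijective g.

(* The operations of the direct product of the [C i] are componentwise, so an *)
(* embedding into it is an injective map into [forall i, C i] all of whose    *)
(* components are homomorphisms.                                              *)
Definition subdirectly_irreducible (pt : bool) (d : Order.disp_t)
    (A : crlType pt d) : Prop :=
  forall (I : Type) (C : I -> crlType pt d) (f : A -> forall i : I, C i),
    injective f ->
    (forall i : I, crl_hom (fun a => f a i)) ->
    (forall (i : I) (c : C i), exists a : A, f a i = c) ->
    exists i : I, crl_isomorphic A (C i).

(* [Bot] is needed to write canonical formulas; it always denotes the least   *)
(* element, whereas [Zero] is unconstrained.                                  *)
Inductive formula (pt : bool) : Type :=
| Var of nat
| One
| Bot
| Zero of pt
| Mul of formula pt & formula pt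
| Imp of formula pt & formula pt
| Meet of formula pt & formula pt
| Join of formula pt & formula pt.

Arguments Var {pt} n.
Arguments One {pt}.
Arguments Bot {pt}.
Arguments Zero {pt} h.

Section Formulas.
Variable pt : bool.
Implicit Types (p q r : formula pt) (G D : seq (formula pt)).

Definition Iff p q := Meet (Imp p q) (Imp q p).

(* Same convention as [x ^+ n] in monoids: p^0 = 1, p^1 = p, p^2 = p p.       *)
Definition Pow p (n : nat) := iterop n (@Mul pt) p One.

Definition bigMeet (s : seq (formula pt)) := foldr (@Meet pt) One s.
Definition bigJoin (s : seq (formula pt)) := foldr (@Join pt) Bot s.

Fixpoint eval (d : Order.disp_t) (B : cirlType pt d) (v : nat -> B) p : B :=
  match p with
  | Var n => v n
  | One => 1%g
  | Bot => \bot
  | Zero h => zero h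
  | Mul q r => (eval v q * eval v r)%g
  | Imp q r => imp (eval v q) (eval v r)
  | Meet q r => eval v q `&` eval v r
  | Join q r => eval v q `|` eval v r
  end.

Definition valid (d : Order.disp_t) (B : cirlType pt d) p : Prop :=
  forall v : nat -> B, eval v p = 1%g.

(* Sequent calculus FL with exchange and weakening, plus the k-potency axiom. *)
(* Every sequent has exactly one formula on the right, so that there is no    *)
(* rule forcing [Zero] to be the least element.                               *)
Inductive FLew (k : nat) : seq (formula pt) -> formula pt -> Prop :=
| FL_id p : FLew k [:: p] p
| FL_cut G D p q : FLew k G p -> FLew k (p :: D) q -> FLew k (G ++ D) q
| FL_exchange G D p q r :
    FLew k (G ++ [:: p, q & D]) r -> FLew k (G ++ [:: q, p & D]) r
| FL_weakening G p q : FLew k G q -> FLew k (p :: G) q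
| FL_BotL G p : FLew k (Bot :: G) p
| FL_OneL G p : FLew k G p -> FLew k (One :: G) p
| FL_OneR : FLew k [::] One
| FL_MulL G p q r : FLew k [:: p, q & G] r -> FLew k (Mul p q :: G) r
| FL_MulR G D p q : FLew k G p -> FLew k D q -> FLew k (G ++ D) (Mul p q)
| FL_ImpL G D p q r :
    FLew k G p -> FLew k (q :: D) r -> FLew k (Imp p q :: G ++ D) r
| FL_ImpR G p q : FLew k (p :: G) q -> FLew k G (Imp p q)
| FL_MeetL1 G p q r : FLew k (p :: G) r -> FLew k (Meet p q :: G) r
| FL_MeetL2 G p q r : FLew k (q :: G) r -> FLew k (Meet p q :: G) r
| FL_MeetR G p q : FLew k G p -> FLew k G q -> FLew k G (Meet p q)
| FL_JoinL G p q r :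
    FLew k (p :: G) r -> FLew k (q :: G) r -> FLew k (Join p q :: G) r
| FL_JoinR1 G p q : FLew k G p -> FLew k G (Join p q)
| FL_JoinR2 G p q : FLew k G q -> FLew k G (Join p q)
| FL_kpotency p : FLew k [::] (Iff (Pow p k) (Pow p k.+1)).

Definition FLew_provable (k : nat) p : Prop := FLew k [::] p.

End Formulas.

Section Canonical.
Variables (k : nat) (pt : bool) (d : Order.disp_t) (A : finKcirlType k pt d).

Definition X (a : A) : formula pt := Var (enum_rank a).

(* Without this clause, validity of canonical formulas would not depend on    *)
(* the value of 0, and no set of them could be equivalent to [Zero] itself.   *)
Definition zero_clause : seq (formula pt) :=
  match @idP pt with
  | ReflectT h => [:: Iff (X (zero h)) (Zero h)]
  | ReflectF _ => [::]
  end.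

Definition Gamma (Dmeet Dimp : {set A * A}) : formula pt :=
  bigMeet (
    [:: Iff (X \bot) Bot; Iff (X 1%g) One]
    ++ zero_clause
    ++ [seq Iff (X (a * b)%g) (Mul (X a) (X b)) | a <- enum A, b <- enum A]
    ++ [seq Iff (X (a `|` b)) (Join (X a) (X b)) | a <- enum A, b <- enum A]
    ++ [seq Iff (X (imp ab.1 ab.2)) (Imp (X ab.1) (X ab.2)) | ab <- enum Dimp]
    ++ [seq Iff (X (ab.1 `&` ab.2)) (Meet (X ab.1) (X ab.2))
         | ab <- enum Dmeet]).

Definition Delta : formula pt :=
  bigJoin [seq Imp (X ab.1) (X ab.2)
            | ab : A * A <- enum {: A * A} & ~~ (ab.1 <= ab.2)].

Definition canonical_formula (Dmeet Dimp : {set A * A}) : formula pt :=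
  Imp (Pow (Gamma Dmeet Dimp) k) Delta.

End Canonical.

(* Main.v *)
(* Let v refute phi in B.  For an idempotent c of B, the quotient of B by the *)
(* filter of c is represented inside B by the elements c x.  Scaling by c the *)
(* (mul, join, bot)-subalgebra generated by 1, 0 and the values of the        *)
(* subformulas of phi gives a set S_c, which k-potency makes finite, of size  *)
(* bounded in terms of k and phi only; residuals and meets computed inside    *)
(* S_c turn it into an algebra.  Among the idempotents c that are not below   *)
(* v(phi), take one with |S_c| minimal.  Then c is not below the join D of    *)
(* the x -> y with x, y in S_c and not x <= y: otherwise, since D^k is below  *)
(* the join of the (x -> y)^k, some c' = c (x -> y)^k is still not below      *)
(* v(phi), and c' identifies x \/ y with y, so S_c' is smaller.  This choice  *)
(* of c replaces a subdirectly irreducible quotient of B: it makes S_c        *)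
(* subdirectly irreducible, lets S_c refute phi, and makes B refute the       *)
(* canonical formula of S_c.  Conversely an algebra refuting the canonical    *)
(* formula of a refutation of phi refutes phi.  The canonical formulas of     *)
(* algebras of bounded size form a finite set, and it is not empty because    *)
(* the Lindenbaum algebra refutes phi.                                        *)

Require Import Defs.
From HB Require Import structures.
From mathcomp Require Import all_boot all_order.
From mathcomp Require Import boolp classical_sets cardinality generic_quotient.
From mathcomp Require Import zify.

Set Implicit Arguments.
Unset Strict Implicit.
Unset Printing Implicit Defensive.

Import Order.TTheory.
Local Open Scope order_scope.
Local Open Scope group_scope.

(** * Integral residuated lattices *)

(** A map [f : A -> B] that satisfies the clauses of [Gamma] modulo the filter of an idempotent [c]
    commutes, modulo that filter, with the evaluation of phi ([mod_hom_eval]), as soon as the two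
    sets of pairs contain every meet and residual formed in that evaluation. So if B refutes the
    canonical formula of a refutation of phi in A, the k-th power of the value of [Gamma] is an
    idempotent that carries this refutation over to B ([valid_refutation_formula]).

    Conversely, [exists_refutation] extracts A from a refutation in B, as a finite (mul,
    join)-subalgebra scaled by an idempotent [c]. If [c] were below the value of [Delta],
    [idem_le_joins] would give a smaller idempotent that still refutes phi, and [size_generated_lt]
    would contradict the minimality of A. That [c] is not below [Delta] yields both subdirect
    irreducibility ([frame_subdirectly_irreducible]) and the failure of the canonical formula
    ([refutation_formula_invalid]).

    A bound on the size of A bounds the variables and the depth of its canonical formulas, so only
    finitely many formulas arise ([bounded_canonical_formula], [finite_bounded]). By
    [FLew_complete], at least one arises. *)

Section CirlTheory.
Variables (pt : bool) (d : Order.disp_t) (B : cirlType pt d).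
Implicit Types (x y z c e : B) (p q : formula pt) (v : nat -> B).

Lemma crl_mulC : commutative (@mul B).
Proof. exact: mul_comm. Qed.

Lemma crl_mulCA : left_commutative (@mul B).
Proof. by move=> x y z; rewrite !mulgA (crl_mulC x). Qed.

Lemma crl_mulACA : interchange (@mul B) (@mul B).
Proof. by move=> x y z t; rewrite -!mulgA (crl_mulCA y). Qed.

Lemma le_imp x y z : (y <= imp x z) = (x * y <= z).
Proof. by apply/idP/idP => /residuation. Qed.

Lemma mul_imp_le x y : x * imp x y <= y.
Proof. by rewrite -le_imp. Qed.

Lemma lex1g x : x <= 1.
Proof. by rewrite -top_one lex1. Qed.

Lemma mul_le2l x y z : y <= z -> x * y <= x * z.
Proof. by move=> yz; rewrite -le_imp (le_trans yz) // le_imp. Qed.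

Lemma mul_le2 x y z t : x <= y -> z <= t -> x * z <= y * t.
Proof.
move=> xy zt; apply: le_trans (mul_le2l x zt) _.
by rewrite ![_ * t]crl_mulC; exact: mul_le2l.
Qed.

Lemma mul_lel x y : x * y <= x.
Proof. by rewrite -[leRHS]mulg1; apply: mul_le2l (lex1g y). Qed.

Lemma mul_ler x y : x * y <= y.
Proof. by rewrite crl_mulC mul_lel. Qed.

Lemma mulgUr x : {morph mul x : y z / y `|` z}.
Proof.
move=> y z; apply/eqP; rewrite eq_le leUx !mul_le2l ?leUl ?leUr //= andbT.
by rewrite -le_imp leUx !le_imp leUl leUr.
Qed.

Lemma mulg0 x : x * \bot = \bot.
Proof. by apply/eqP; rewrite -lex0 -le_imp le0x. Qed.

Lemma mulg_joinsr (I : Type) (r : seq I) (P : pred I) (F : I -> B) x :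
  x * (\join_(i <- r | P i) F i) = \join_(i <- r | P i) x * F i.
Proof. exact: (big_morph _ (mulgUr x) (mulg0 x)). Qed.

Lemma imp_eq1 x y : (imp x y == 1) = (x <= y).
Proof. by rewrite eq_le lex1g le_imp mulg1. Qed.

Lemma expg_at0 x n : n = 0%N -> x ^+ n = 1.
Proof. by move->. Qed.

Lemma expg_le x y n : x <= y -> x ^+ n <= y ^+ n.
Proof. by move=> xy; elim: n => // n IHn; rewrite !expgS mul_le2. Qed.

Lemma expg_lex x n : (0 < n)%N -> x ^+ n <= x.
Proof. by case: n => // n _; rewrite expgS mul_lel. Qed.

Lemma idem_expg e n : (0 < n)%N -> e * e = e -> e ^+ n = e.
Proof. by case: n => // n _ ee; elim: n => // n IHn; rewrite expgS IHn. Qed.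

(** Each term in the expansion of the left side has [n] factors [x] or [m] factors [y], and its
    other factors are at most 1. *)
Lemma joinX_le x y n m : (x `|` y) ^+ (n + m) <= x ^+ n `|` y ^+ m.
Proof.
elim: n m => [|n IHn] m; first by rewrite (le_trans (lex1g _)) // leUl.
elim: m => [|m IHm]; first by rewrite (le_trans (lex1g _)) // leUr.
rewrite addSn expgS crl_mulC mulgUr leUx; apply/andP; split; rewrite crl_mulC.
  apply: le_trans (mul_le2l x (IHn m.+1)) _.
  by rewrite mulgUr leU2 -?expgS // mul_ler.
apply: le_trans (mul_le2l y _) _; first by rewrite addnS -addSn; exact: IHm.
by rewrite mulgUr leU2 -?expgS // mul_ler.
Qed.

(* Congruence modulo the filter generated by c, when c is idempotent. *)
Definition eqm c x y := (c * x <= y) && (c * y <= x).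

Lemma eqm_refl c x : eqm c x x.
Proof. by rewrite /eqm mul_ler. Qed.

Lemma eqm_sym c x y : eqm c x y = eqm c y x.
Proof. by rewrite /eqm andbC. Qed.

Lemma eqm_iff c x y : eqm c x y = (c <= imp x y `&` imp y x).
Proof. by rewrite lexI !le_imp ![_ * c]crl_mulC. Qed.

Lemma le_mod_trans c x y z : c * c = c -> c * x <= y -> c * y <= z -> c * x <= z.
Proof. by move=> cc xy; rewrite -{2}cc -mulgA; apply: le_trans (mul_le2l _ xy). Qed.

Lemma eqm_trans c x y z : c * c = c -> eqm c x y -> eqm c y z -> eqm c x z.
Proof.
move=> cc /andP[xy yx] /andP[yz zy].
by rewrite /eqm (le_mod_trans cc xy yz) (le_mod_trans cc zy yx).
Qed.

Lemma eqm_mul c x x' y y' : c * c = c ->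
  eqm c x x' -> eqm c y y' -> eqm c (x * y) (x' * y').
Proof.
move=> cc /andP[xx' x'x] /andP[yy' y'y]; rewrite /eqm -{1 2}cc.
by rewrite !(crl_mulACA c c) !mul_le2.
Qed.

Lemma eqm_join c x x' y y' :
  eqm c x x' -> eqm c y y' -> eqm c (x `|` y) (x' `|` y').
Proof.
by move=> /andP[xx' x'x] /andP[yy' y'y]; rewrite /eqm !mulgUr !leU2.
Qed.

Lemma eqm_meet c x x' y y' :
  eqm c x x' -> eqm c y y' -> eqm c (x `&` y) (x' `&` y').
Proof.
have mod_meet a a' b b' : c * a <= a' -> c * b <= b' ->
    c * (a `&` b) <= a' `&` b'.
  move=> aa' bb'; rewrite lexI.
  by rewrite (le_trans _ aa') ?(le_trans _ bb') // mul_le2l ?leIl ?leIr.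
by move=> /andP[xx' x'x] /andP[yy' y'y]; rewrite /eqm !mod_meet.
Qed.

Lemma imp_mod c x x' y y' : c * c = c ->
  c * x' <= x -> c * y <= y' -> c * imp x y <= imp x' y'.
Proof.
move=> cc x'x yy'; rewrite le_imp.
have -> : x' * (c * imp x y) = c * (c * x' * imp x y).
  by rewrite -{1}cc -!mulgA crl_mulCA (crl_mulCA x').
rewrite (le_trans _ yy') // mul_le2l // (le_trans _ (mul_imp_le x y)) //.
exact: mul_le2.
Qed.

Lemma eqm_imp c x x' y y' : c * c = c ->
  eqm c x x' -> eqm c y y' -> eqm c (imp x y) (imp x' y').
Proof.
move=> cc /andP[xx' x'x] /andP[yy' y'y].
by rewrite /eqm !imp_mod.
Qed.

Lemma eval_Pow v p n : eval v (Pow p n) = eval v p ^+ n.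
Proof. by case: n => // n; elim: n => //= n ->. Qed.

Lemma le_bigMeet v s c :
  (c <= eval v (bigMeet s)) = all (fun p => c <= eval v p) s.
Proof. by elim: s => [|p s IHs] /=; rewrite ?lex1g // lexI IHs. Qed.

Lemma eval_bigJoin v s : eval v (bigJoin s) = \join_(p <- s) eval v p.
Proof. by elim: s => [|p s IHs] /=; rewrite ?big_nil // big_cons IHs. Qed.

End CirlTheory.

Section KPotent.
Variables (k : nat) (pt : bool) (d : Order.disp_t) (B : kcirlType k pt d).
Implicit Types (x y z c e : B).

Lemma kpotentD x n : x ^+ (k + n) = x ^+ k.
Proof.
by elim: n => [|n IHn]; rewrite ?addn0 // addnS expgSr IHn -expgSr -kpotent.
Qed.

Lemma expgk_idem x : x ^+ k * x ^+ k = x ^+ k.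
Proof. by rewrite -expgnDr kpotentD. Qed.

Lemma expgk_min x n : x ^+ minn n k = x ^+ n.
Proof.
by case: leqP => // /ltnW/subnKC <-; rewrite kpotentD.
Qed.

(** For [k = 0] potency reads 1 = x, so a refutation excludes this degenerate case. *)
Lemma k_gt0 x : x != 1 -> (0 < k)%N.
Proof.
rewrite lt0n; apply: contraNN => /eqP k0.
have xk : x ^+ k = 1 by exact: expg_at0.
by move: (kpotent x); rewrite expgS xk mulg1 => <-.
Qed.

Lemma idem_le_expgk c x : c * c = c -> c <= x -> c <= x ^+ k.
Proof.
move=> cc cx; case: (posnP k) => [k0|k0]; first by rewrite expg_at0 ?lex1g.
by rewrite -[leLHS](idem_expg k0 cc) expg_le.
Qed.

(** By k-potency the exponent may be doubled, which puts [joinX_le] within reach. *)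
Lemma joinXk_le x y : (x `|` y) ^+ k <= x ^+ k `|` y ^+ k.
Proof. by rewrite -(kpotentD (x `|` y) k) joinX_le. Qed.

Lemma joinsXk_le (I : Type) (r : seq I) (P : pred I) (F : I -> B) : (0 < k)%N ->
  (\join_(i <- r | P i) F i) ^+ k <= \join_(i <- r | P i) F i ^+ k.
Proof.
move=> k0; elim/big_rec2: _ => [|i y x _ xy].
  by rewrite idem_expg ?mulg0.
by rewrite (le_trans (joinXk_le _ _)) // leU2.
Qed.

(** Being idempotent, [c] is below the k-th power of the join, hence below the join of the k-th
    powers. Used contrapositively: if [c] is not below [p], some [c * F i ^+ k] is not below [p]
    either and can replace [c]. *)
Lemma idem_le_joins (I : Type) (r : seq I) (P : pred I) (F : I -> B) c p :
  (0 < k)%N -> c * c = c -> c <= \join_(i <- r | P i) F i ->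
  (forall i, P i -> c * F i ^+ k <= p) -> c <= p.
Proof.
move=> k0 cc /(idem_le_expgk cc) cF Fp.
rewrite -cc (le_trans (mul_le2l c cF)) //.
rewrite (le_trans (mul_le2l c (joinsXk_le _ _ _ k0))) //.
rewrite mulg_joinsr; elim/big_rec: _ => [|i x /Fp Fip xp]; first exact: le0x.
by rewrite leUx Fip.
Qed.

End KPotent.

(** * Finite quotients of (mul, join)-subalgebras *)

(* Models s = {c * x | x in S} with c idempotent and S a (mul, join)-closed    *)
(* subset of B containing 1, bot and zero; c * x stands for the class of x    *)
(* modulo the filter generated by c.                                          *)
Record frame (k : nat) (pt : bool) (d : Order.disp_t) (B : kcirlType k pt d)
    (s : seq B) (c : B) : Prop := Frame {
  frame_unit : c \in s;
  frame_mul1 : {in s, forall x, c * x = x};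
  frame_mul : {in s &, forall x y, x * y \in s};
  frame_join : {in s &, forall x y, x `|` y \in s};
  frame_bot : \bot \in s;
  frame_zero : forall h : pt, c * Defs.zero h \in s
}.

(** The alias carries the display and the frame proof because the instances declared on it below
    refer to both. *)
Definition frame_alg (dA : Order.disp_t) (k : nat) (pt : bool)
    (d : Order.disp_t) (B : kcirlType k pt d) (s : seq B) (c : B)
    of frame s c : Type := seq_sub s.

Section FrameAlgebra.
Variables (dA : Order.disp_t) (k : nat) (pt : bool) (d : Order.disp_t).
Variables (B : kcirlType k pt d) (s : seq B) (c : B) (Fs : frame s c).
Local Notation A := (frame_alg dA Fs).
Implicit Types (x y z : A).

HB.instance Definition _ := Finite.on A.

Definition frame_val (x : A) : B := ssval x.
Local Notation fval := frame_val.

Definition frame_elt (b : B) (bs : b \in s) : A := SeqSub bs.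

Lemma fval_mem x : fval x \in s.
Proof. exact: ssvalP. Qed.
Hint Resolve fval_mem : core.

Lemma fval_inj : injective fval.
Proof. exact: val_inj. Qed.

Definition frame_le x y := fval x <= fval y.

Fact frame_le_refl : reflexive frame_le.
Proof. by move=> x; apply: lexx. Qed.

Fact frame_le_anti : antisymmetric frame_le.
Proof. by move=> x y /le_anti/fval_inj. Qed.

Fact frame_le_trans : transitive frame_le.
Proof. by move=> y x z; apply: le_trans. Qed.

HB.instance Definition _ :=
  Order.Le_isPOrder.Build dA A frame_le_refl frame_le_anti frame_le_trans.

Lemma fval_le x y : (x <= y) = (fval x <= fval y).
Proof. by []. Qed.

Fact frame_joins_mem (P : pred B) : \join_(b <- s | P b) b \in s.
Proof.
rewrite -big_filter big_seq_cond; elim/big_ind: _.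
- exact: frame_bot Fs.
- by move=> x y xs ys; apply: (frame_join Fs).
- by move=> b; rewrite mem_filter => /andP[/andP[_ ->]].
Qed.

(** Meets and residuals of B may leave [s]. Since [s] is finite and closed under joins, a condition
    stable under joins has a largest solution in [s], and this supplies both operations. *)
Definition frame_lub (P : pred B) : A := frame_elt (frame_joins_mem P).

Lemma fval_lub_ge (P : pred B) x : P (fval x) -> fval x <= fval (frame_lub P).
Proof. by move=> Px; apply: (@joins_sup_seq _ _ _ s P id (fval x)) Px. Qed.

Lemma fval_lub_le (P : pred B) (b : B) :
  (forall x, P (fval x) -> fval x <= b) -> fval (frame_lub P) <= b.
Proof. by move=> Pb; apply/joinsP_seq => a as_ Pa; apply: (Pb (frame_elt as_)). Qed.

Definition frame_mulA x y : A :=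
  frame_elt (frame_mul Fs (fval_mem x) (fval_mem y)).
Definition frame_joinA x y : A :=
  frame_elt (frame_join Fs (fval_mem x) (fval_mem y)).
Definition frame_meetA x y : A :=
  frame_lub (fun b => (b <= fval x) && (b <= fval y)).
Definition frame_impA x y : A :=
  frame_lub (fun b => fval x * b <= fval y).

Fact frame_lexI x y z : (x <= frame_meetA y z) = (x <= y) && (x <= z).
Proof.
rewrite !fval_le; apply/idP/idP => [xyz|xyz]; last exact: fval_lub_ge.
by rewrite !(le_trans xyz) //; apply: fval_lub_le => u /andP[].
Qed.

Fact frame_leUx x y z : (frame_joinA x y <= z) = (x <= z) && (y <= z).
Proof. exact: leUx. Qed.

HB.instance Definition _ := Order.POrder_MeetJoin_isLattice.Build dA A
  frame_lexI frame_leUx.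

Fact frame_mulAA : associative frame_mulA.
Proof. by move=> x y z; apply: fval_inj; apply: mulgA. Qed.

Fact frame_mul1A : left_id (frame_elt (frame_unit Fs)) frame_mulA.
Proof. by move=> x; apply: fval_inj; apply: (frame_mul1 Fs). Qed.

Fact frame_mulA1 : right_id (frame_elt (frame_unit Fs)) frame_mulA.
Proof.
by move=> x; apply: fval_inj; rewrite -[RHS](frame_mul1 Fs (fval_mem x)) crl_mulC.
Qed.

HB.instance Definition _ :=
  isMonoid.Build A frame_mulAA frame_mul1A frame_mulA1.

Lemma fval_mul x y : fval (x * y) = fval x * fval y.
Proof. by []. Qed.

Lemma fval_join x y : fval (x `|` y) = fval x `|` fval y.
Proof. by []. Qed.

Lemma fval_one : fval 1 = c.
Proof. by []. Qed.

Fact frame_mulAC x y : x * y = y * x.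
Proof. by apply: fval_inj; apply: crl_mulC. Qed.

Fact frame_residuation x y z : x * y <= z <-> y <= frame_impA x z.
Proof.
rewrite !fval_le fval_mul; split=> [xyz|/(mul_le2l (fval x))/le_trans].
  exact: fval_lub_ge.
by apply; rewrite -le_imp; apply: fval_lub_le => u; rewrite le_imp.
Qed.

HB.instance Definition _ := isCRL.Build pt dA A
  (fun h => frame_elt (frame_zero Fs h)) frame_mulAC frame_residuation.

Fact frame_le0 x : frame_elt (frame_bot Fs) <= x.
Proof. exact: le0x. Qed.

Fact frame_le1 x : x <= 1.
Proof. by rewrite fval_le fval_one -(frame_mul1 Fs (fval_mem x)) mul_lel. Qed.

HB.instance Definition _ := Order.hasBottom.Build dA A frame_le0.
HB.instance Definition _ := Order.hasTop.Build dA A frame_le1.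
HB.instance Definition _ := isIntegral.Build pt dA A erefl.

(** The factor [c] matters at [n = 0], where the unit of the frame algebra is [c] and not 1. *)
Lemma fval_exp x n : fval (x ^+ n) = c * fval x ^+ n.
Proof.
elim: n => [|n IHn]; first by rewrite mulg1.
by rewrite !expgS fval_mul IHn crl_mulCA.
Qed.

Fact frame_kpotent x : x ^+ k = x ^+ k.+1.
Proof. by apply: fval_inj; rewrite !fval_exp kpotent. Qed.

HB.instance Definition _ := isKPotent.Build k pt dA A frame_kpotent.

Lemma fval_bot : fval \bot = \bot.
Proof. by []. Qed.

End FrameAlgebra.

Definition frame_algebra (dA : Order.disp_t) (k : nat) (pt : bool)
    (d : Order.disp_t) (B : kcirlType k pt d) (s : seq B) (c : B)
    (Fs : frame s c) : finKcirlType k pt dA := frame_alg dA Fs.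

Arguments frame_val : simpl never.

(** * Canonical formulas *)

(** A component that identifies two distinct elements sends some residual below [e] to 1, hence
    identifies [e] with 1. If every component did so, injectivity of [f] would give e = 1. *)
Lemma subdirectly_irreducible_coatom (pt : bool) (d : Order.disp_t)
    (A : cirlType pt d) (e : A) :
  e != 1 -> (forall a, a != 1 -> a <= e) -> subdirectly_irreducible A.
Proof.
move=> e1 max_e I C f f_inj f_hom f_surj; apply: contrapT => no_iso.
suff fe i : f e i = f 1 i.
  by case/eqP: e1; apply: f_inj; apply: functional_extensionality_dep.
have f_mor := f_hom i; apply: contrapT => fe; apply: no_iso; exists i.
exists (f^~ i) => //.
suff inj_fi : injective (f^~ i).
  exists (fun b => sval (cid (f_surj i b))) => [a|b]; last by case: cid.
  by apply: inj_fi; case: cid.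
have le_inj a b : f a i = f b i -> a <= b.
  move=> fab; rewrite -imp_eq1; apply: contraPT fe => /max_e le_e.
  have f_t : f (imp a b) i = f 1 i.
    rewrite (hom_imp f_mor) fab -(hom_imp f_mor).
    by congr (f _ i); apply/eqP; rewrite imp_eq1.
  (* Writing t for [imp a b]: e = t \/ e and 1 = 1 \/ e, while t and 1 have the same image. *)
  rewrite -(join_r le_e) -[in RHS](join_l (lex1g e)).
  by rewrite !(hom_join f_mor) f_t.
by move=> a b fab; apply: le_anti; rewrite !le_inj.
Qed.

Section CanonicalFormulas.
Variables (k : nat) (pt : bool) (dA d : Order.disp_t).
Variables (A : finKcirlType k pt dA) (B : kcirlType k pt d).
Implicit Types (a b : A) (c : B) (w : nat -> B) (f : A -> B).

(** The clauses of [Gamma], read in the quotient of B by the filter of [c]. *)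
Record mod_hom c f (Dmeet Dimp : {set A * A}) : Prop := ModHom {
  mod_hom_bot : eqm c (f \bot) \bot;
  mod_hom_one : eqm c (f 1) 1;
  mod_hom_zero : forall h : pt, eqm c (f (Defs.zero h)) (Defs.zero h);
  mod_hom_mul : forall a b, eqm c (f (a * b)) (f a * f b);
  mod_hom_join : forall a b, eqm c (f (a `|` b)) (f a `|` f b);
  mod_hom_imp : forall a b, (a, b) \in Dimp ->
    eqm c (f (imp a b)) (imp (f a) (f b));
  mod_hom_meet : forall a b, (a, b) \in Dmeet ->
    eqm c (f (a `&` b)) (f a `&` f b)
}.

Lemma all_zero_clause (P : pred (formula pt)) :
  all P (zero_clause A) <->
  forall h : pt, P (Iff (X (Defs.zero h : A)) (Zero h)).
Proof.
(* Abstracting the proof [idP] makes the dependent match open to case analysis. *)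
have all_reflect (b0 : bool) (r : reflect pt b0) (F : pt -> formula pt) :
    all P (match r with ReflectT h => [:: F h] | ReflectF _ => [::] end) <->
    forall h, P (F h).
  case: r => [h|nh] /=; last by split=> // _ h; case: nh.
  rewrite andbT; split=> [Ph h'|]; last exact.
  by rewrite (bool_irrelevance h' h).
exact: all_reflect.
Qed.

Lemma le_Gamma w c (Dmeet Dimp : {set A * A}) :
  c <= eval w (Gamma Dmeet Dimp) <->
  mod_hom c (fun a => w (enum_rank a)) Dmeet Dimp.
Proof.
rewrite le_bigMeet /= !all_cat !all_map -!eqm_iff.
split.
  case/and3P=> fbot fone /and5P[/all_zero_clause fzero].
  move=> /all_allpairsP fmul /all_allpairsP fjoin /allP fimp /allP fmeet.
  split=> //.
  - by move=> h; rewrite eqm_iff; apply: fzero.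
  - by move=> a b; rewrite eqm_iff; apply: fmul; rewrite mem_enum.
  - by move=> a b; rewrite eqm_iff; apply: fjoin; rewrite mem_enum.
  - move=> a b Dab; rewrite eqm_iff.
    by apply: (fimp (a, b)); rewrite mem_enum.
  - move=> a b Dab; rewrite eqm_iff.
    by apply: (fmeet (a, b)); rewrite mem_enum.
case=> -> -> fzero fmul fjoin fimp fmeet /=; apply/and5P; split.
- by apply/all_zero_clause => h; rewrite /= -eqm_iff.
- by apply/all_allpairsP => a b _ _; rewrite /= -eqm_iff.
- by apply/all_allpairsP => a b _ _; rewrite /= -eqm_iff.
- by apply/allP => -[a b]; rewrite mem_enum /= -eqm_iff; exact: fimp.
- by apply/allP => -[a b]; rewrite mem_enum /= -eqm_iff; exact: fmeet.
Qed.

Lemma eval_Delta w :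
  eval w (Delta A) = \join_(ab : A * A | ~~ (ab.1 <= ab.2))
    imp (w (enum_rank ab.1)) (w (enum_rank ab.2)).
Proof. by rewrite eval_bigJoin big_map big_filter big_enum_cond. Qed.

Fixpoint imp_pairs (u : nat -> A) (p : formula pt) : seq (A * A) :=
  match p with
  | Imp q r => (eval u q, eval u r) :: imp_pairs u q ++ imp_pairs u r
  | Mul q r | Meet q r | Join q r => imp_pairs u q ++ imp_pairs u r
  | _ => [::]
  end.

Fixpoint meet_pairs (u : nat -> A) (p : formula pt) : seq (A * A) :=
  match p with
  | Meet q r => (eval u q, eval u r) :: meet_pairs u q ++ meet_pairs u r
  | Mul q r | Imp q r | Join q r => meet_pairs u q ++ meet_pairs u r
  | _ => [::]
  end.

(** The chosen pairs are exactly the meets and residuals computed while evaluating [p] under [u];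
    this is all that [mod_hom_eval] asks for. *)
Definition refutation_formula (u : nat -> A) (p : formula pt) : formula pt :=
  canonical_formula [set ab in meet_pairs u p] [set ab in imp_pairs u p].

Lemma mod_hom_eval c f (Dmeet Dimp : {set A * A}) (u : nat -> A) p :
  c * c = c -> mod_hom c f Dmeet Dimp ->
  {subset meet_pairs u p <= Dmeet} -> {subset imp_pairs u p <= Dimp} ->
  eqm c (f (eval u p)) (eval (f \o u) p).
Proof.
move=> cc [fbot fone fzero fmul fjoin fimp fmeet].
elim: p => [n|||h|q IHq r IHr|q IHq r IHr|q IHq r IHr|q IHq r IHr] //= Dm Di.
- exact: eqm_refl.
- apply: eqm_trans (fmul _ _) (eqm_mul cc _ _) => //; [apply: IHq|apply: IHr];
  by move=> x xs; rewrite ?Dm ?Di // ?inE mem_cat xs ?orbT.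
- apply: eqm_trans (fimp _ _ _) (eqm_imp cc _ _) => //; first by rewrite Di ?mem_head.
    by apply: IHq => x xs; rewrite ?Dm ?Di // ?inE mem_cat xs ?orbT.
  by apply: IHr => x xs; rewrite ?Dm ?Di // ?inE mem_cat xs ?orbT.
- apply: eqm_trans (fmeet _ _ _) (eqm_meet _ _) => //; first by rewrite Dm ?mem_head.
    by apply: IHq => x xs; rewrite ?Dm ?Di // ?inE mem_cat xs ?orbT.
  by apply: IHr => x xs; rewrite ?Dm ?Di // ?inE mem_cat xs ?orbT.
- apply: eqm_trans (fjoin _ _) (eqm_join _ _) => //; [apply: IHq|apply: IHr];
  by move=> x xs; rewrite ?Dm ?Di // ?inE mem_cat xs ?orbT.
Qed.

Lemma valid_refutation_formula (u : nat -> A) p :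
  eval u p != 1 -> valid B p -> valid B (refutation_formula u p).
Proof.
move=> up1 Bp w; apply/eqP; apply: contraT => gamma_ne1.
have k0 := k_gt0 gamma_ne1.
move: gamma_ne1; rewrite /= imp_eq1 eval_Pow eval_Delta.
set g := eval w _ => /negP[].
have gg := expgk_idem g.
have /le_Gamma fm : g ^+ k <= g by exact: expg_lex.
have sub_set (r : seq (A * A)) : {subset r <= [set ab in r]}.
  by move=> ab; rewrite inE.
have /andP[_] := mod_hom_eval gg fm (sub_set _) (sub_set _).
rewrite Bp mulg1 => g_le.
(* The disjunct of [Delta] that is reached is X_1 -> X_a with a the value of [p] under [u]. *)
apply: le_trans (joins_sup (j := (1, eval u p)) _ _) => /=; last first.
  by apply: contraNN up1 => up1; rewrite eq_le lex1g.
by rewrite le_imp; apply: le_trans (mul_ler _ _) g_le.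
Qed.

End CanonicalFormulas.

Section Refutation.
Variables (dA : Order.disp_t) (k : nat) (pt : bool) (d : Order.disp_t).
Variables (B : kcirlType k pt d) (s : seq B) (c : B) (Fs : frame s c).
Local Notation A := (frame_algebra dA Fs).
Local Notation fval := (@frame_val dA k pt d B s c Fs).
Implicit Types (x y z : B) (a b : A) (p q : formula pt).

Lemma frame_idem : c * c = c.
Proof. exact: frame_mul1 Fs _ (frame_unit Fs). Qed.
Local Notation cc := frame_idem.

Lemma fval_scale a : c * fval a = fval a.
Proof. exact: frame_mul1 Fs _ (fval_mem a). Qed.

Lemma eqm_scale x : eqm c (c * x) x.
Proof. by rewrite /eqm mulgA cc mul_ler lexx. Qed.

(** The element c(x -> y) represents the residual in the quotient of B; when it lies in [s], the
    largest solution inside [s] attains it. *)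
Lemma fval_imp a b x y : fval a = c * x -> fval b = c * y ->
  c * imp x y \in s -> fval (imp a b) = c * imp x y.
Proof.
move=> ax byy xys; apply: le_anti; apply/andP; split.
  rewrite -fval_scale -{1}cc -mulgA mul_le2l // le_imp crl_mulCA mulgA -ax.
  rewrite -fval_mul (le_trans (mul_imp_le a b : fval (a * imp a b) <= fval b)) //.
  by rewrite byy mul_ler.
change (fval (frame_elt dA Fs xys) <= fval (imp a b)).
rewrite -fval_le le_imp fval_le fval_mul ax byy.
by rewrite crl_mulACA cc mul_le2l // mul_imp_le.
Qed.

Lemma fval_meet a b x y : fval a = c * x -> fval b = c * y ->
  c * (x `&` y) \in s -> fval (a `&` b) = c * (x `&` y).
Proof.
move=> ax byy xys; apply: le_anti; apply/andP; split.
  rewrite -fval_scale mul_le2l // lexI.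
  rewrite (le_trans (leIl a b : fval (a `&` b) <= fval a)) ?ax ?mul_ler //.
  by rewrite (le_trans (leIr b a : fval (a `&` b) <= fval b)) ?byy ?mul_ler.
change (fval (frame_elt dA Fs xys) <= fval (a `&` b)).
by rewrite -fval_le lexI !fval_le ax byy !mul_le2l ?leIl ?leIr.
Qed.

Fixpoint subvalues (v : nat -> B) p : seq B :=
  eval v p :: match p with
  | Mul q r | Imp q r | Meet q r | Join q r => subvalues v q ++ subvalues v r
  | _ => [::]
  end.

Variable v : nat -> B.

(** The default 1 serves variables whose scaled value is outside [s]; no variable of the refuted
    formula is of this kind. *)
Definition frame_valuation (n : nat) : A :=
  odflt 1 [pick a | fval a == c * v n].
Local Notation u := frame_valuation.

Lemma fval_valuation n : c * v n \in s -> fval (u n) = c * v n.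
Proof.
rewrite /u => vns; case: pickP => [a /eqP //|/(_ (frame_elt dA Fs vns))].
by rewrite eqxx.
Qed.

Lemma fval_eval p : (forall x, x \in subvalues v p -> c * x \in s) ->
  fval (eval u p) = c * eval v p.
Proof.
elim: p => [n|||h|q IHq r IHr|q IHq r IHr|q IHq r IHr|q IHq r IHr] /= ps.
- by apply: fval_valuation; rewrite ps ?mem_head.
- by rewrite mulg1.
- by rewrite mulg0.
- by [].
all: have {}IHq : fval (eval u q) = c * eval v q by
  apply: IHq => x xs; rewrite ps // inE mem_cat xs orbT.
all: have {}IHr : fval (eval u r) = c * eval v r by
  apply: IHr => x xs; rewrite ps // inE mem_cat xs !orbT.
- transitivity (fval (eval u q) * fval (eval u r)) => //.
  by rewrite IHq IHr crl_mulACA cc.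
- by apply: fval_imp; rewrite // ps ?mem_head.
- by apply: fval_meet; rewrite // ps ?mem_head.
- by transitivity (fval (eval u q) `|` fval (eval u r)); rewrite // IHq IHr mulgUr.
Qed.

Lemma fval_imp_pairs p a b : (forall x, x \in subvalues v p -> c * x \in s) ->
  (a, b) \in imp_pairs u p -> eqm c (fval (imp a b)) (imp (fval a) (fval b)).
Proof.
elim: p => [n|||h|q IHq r IHr|q IHq r IHr|q IHq r IHr|q IHq r IHr] //= ps.
all: have qs x : x \in subvalues v q -> c * x \in s by
  move=> xs; rewrite ps // inE mem_cat xs orbT.
all: have rs x : x \in subvalues v r -> c * x \in s by
  move=> xs; rewrite ps // inE mem_cat xs !orbT.
- by rewrite mem_cat => /orP[/IHq|/IHr]; apply.
- rewrite inE mem_cat => /or3P[/eqP[-> ->]|/IHq|/IHr]; [|exact|exact].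
  have uq := fval_eval qs; have ur := fval_eval rs.
  rewrite (fval_imp uq ur) ?ps ?mem_head // uq ur.
  apply: eqm_trans cc (eqm_scale _) _.
  by apply: eqm_imp cc _ _; rewrite eqm_sym eqm_scale.
- by rewrite mem_cat => /orP[/IHq|/IHr]; apply.
- by rewrite mem_cat => /orP[/IHq|/IHr]; apply.
Qed.

Lemma fval_meet_pairs p a b : (forall x, x \in subvalues v p -> c * x \in s) ->
  (a, b) \in meet_pairs u p -> eqm c (fval (a `&` b)) (fval a `&` fval b).
Proof.
elim: p => [n|||h|q IHq r IHr|q IHq r IHr|q IHq r IHr|q IHq r IHr] //= ps.
all: have qs x : x \in subvalues v q -> c * x \in s by
  move=> xs; rewrite ps // inE mem_cat xs orbT.
all: have rs x : x \in subvalues v r -> c * x \in s by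
  move=> xs; rewrite ps // inE mem_cat xs !orbT.
- by rewrite mem_cat => /orP[/IHq|/IHr]; apply.
- by rewrite mem_cat => /orP[/IHq|/IHr]; apply.
- rewrite inE mem_cat => /or3P[/eqP[-> ->]|/IHq|/IHr]; [|exact|exact].
  have uq := fval_eval qs; have ur := fval_eval rs.
  rewrite (fval_meet uq ur) ?ps ?mem_head // uq ur.
  apply: eqm_trans cc (eqm_scale _) _.
  by apply: eqm_meet; rewrite eqm_sym eqm_scale.
- by rewrite mem_cat => /orP[/IHq|/IHr]; apply.
Qed.

Definition frame_tuple (n : nat) : B := nth 1 (map fval (enum A)) n.

Lemma frame_tuple_rank a : frame_tuple (enum_rank a) = fval a.
Proof.
by rewrite /frame_tuple (nth_map a) ?nth_enum_rank // -cardE.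
Qed.

(** The valuation is the inclusion of [A] in B. It puts [c] below [Gamma], hence below its k-th
    power by idempotency, whereas [c] is not below [Delta]. *)
Lemma refutation_formula_invalid p : (0 < k)%N ->
  (forall x, x \in subvalues v p -> c * x \in s) ->
  ~~ (c <= \join_(ab : A * A | ~~ (ab.1 <= ab.2)) imp (fval ab.1) (fval ab.2)) ->
  ~ valid B (refutation_formula u p).
Proof.
move=> k0 ps cnle /(_ frame_tuple)/eqP; apply/negP.
rewrite /= imp_eq1 eval_Pow eval_Delta; apply: contraNN cnle.
under eq_bigr do rewrite !frame_tuple_rank.
apply: le_trans; apply: idem_le_expgk cc _; apply/le_Gamma.
have -> : (fun a : A => frame_tuple (enum_rank a)) = fval.
  by apply: funext => a; rewrite frame_tuple_rank.
split.
- exact: eqm_refl.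
- by rewrite /eqm cc mulg1 lex1g lexx.
- by move=> h; apply: eqm_scale.
- by move=> a b; apply: eqm_refl.
- by move=> a b; apply: eqm_refl.
- by move=> a b; rewrite inE; apply: fval_imp_pairs.
- by move=> a b; rewrite inE; apply: fval_meet_pairs.
Qed.

(** The join of the elements other than 1 is a coatom: were it 1, then [c] would be below the join
    of these [a], and each [a] is below the disjunct 1 -> a. *)
Lemma frame_subdirectly_irreducible :
  ~~ (c <= \join_(ab : A * A | ~~ (ab.1 <= ab.2)) imp (fval ab.1) (fval ab.2)) ->
  subdirectly_irreducible A.
Proof.
move=> cnle.
apply: (@subdirectly_irreducible_coatom _ _ _ (\join_(a : A | a != 1) a)).
  apply: contraNneq cnle => e1.
  apply: (@le_trans _ _ (fval (\join_(a : A | a != 1) a))); first by rewrite e1.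
  rewrite (big_morph _ (@fval_join dA k pt d B s c Fs) (fval_bot dA Fs)).
  apply/joinsP => a a1.
  apply: le_trans (joins_sup (j := (1 : A, a)) _ _) => /=.
    by rewrite le_imp mul_ler.
  by apply: contraNN a1 => a1; rewrite eq_le lex1g.
by move=> a a1; apply: joins_sup.
Qed.

End Refutation.

(** * Generated quotients of minimal size *)

Section Generation.
Variables (k : nat) (pt : bool) (d : Order.disp_t) (B : kcirlType k pt d).
Implicit Types (x y z c : B) (g s : seq B).

(** Exponents up to [k] are enough for closure under products, by k-potency. *)
Definition monomials g : seq B :=
  foldr (fun x s => [seq x ^+ e * y | e <- iota 0 k.+1, y <- s]) [:: 1] g.

Lemma monomials_cons x g :
  monomials (x :: g) = [seq x ^+ e * y | e <- iota 0 k.+1, y <- monomials g].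
Proof. by []. Qed.

Lemma size_monomials g : size (monomials g) = (k.+1 ^ size g)%N.
Proof.
elim: g => // x g IHg.
by rewrite monomials_cons size_allpairs size_iota IHg expnS.
Qed.

Lemma one_monomials g : 1 \in monomials g.
Proof.
elim: g => [|x g IHg]; first exact: mem_head.
rewrite monomials_cons; apply/allpairsP; exists (0%N, 1).
by split; rewrite //= mulg1.
Qed.

Lemma mul_monomials g : {in monomials g &, forall x y, x * y \in monomials g}.
Proof.
elim: g => [|x g IHg] y z; first by rewrite !inE => /eqP-> /eqP->; rewrite mulg1.
rewrite !monomials_cons.
move=> /allpairsP[[e y'] yg] /allpairsP[[f z'] zg]; apply/allpairsP.
case: yg => [_ y'g ->]; case: zg => [_ z'g ->].
exists (minn (e + f) k, y' * z'); split; rewrite ?mem_iota.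
- by rewrite add0n ltnS geq_minr.
- exact: IHg.
- by rewrite crl_mulACA expgk_min expgnDr.
Qed.

Lemma sub_monomials g : (0 < k)%N -> {subset g <= monomials g}.
Proof.
move=> k0; elim: g => [//|x g IHg] y.
rewrite monomials_cons inE => /predU1P[->|/IHg yg].
  apply/allpairsP; exists (1%N, 1); split; rewrite ?mem_iota //= ?mulg1 //.
  exact: one_monomials.
by apply/allpairsP; exists (0%N, y); split; rewrite //= mul1g.
Qed.

Definition finite_joins s : seq B :=
  foldr (fun x t => t ++ [seq x `|` y | y <- t]) [:: \bot] s.

Lemma size_finite_joins s : size (finite_joins s) = (2 ^ size s)%N.
Proof.
by elim: s => //= x s IHs; rewrite size_cat size_map IHs addnn expnS mul2n.
Qed.

Lemma bot_finite_joins s : \bot \in finite_joins s.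
Proof. by elim: s => [|x s IHs] /=; rewrite ?mem_head // mem_cat IHs. Qed.

Lemma sub_finite_joins s : {subset s <= finite_joins s}.
Proof.
elim: s => [//|x s IHs] y; rewrite inE mem_cat => /predU1P[->|/IHs -> //].
by rewrite -[X in X \in map _ _]joinx0 map_f ?orbT ?bot_finite_joins.
Qed.

Lemma join_finite_joins s : {in finite_joins s &, forall x y, x `|` y \in finite_joins s}.
Proof.
elim: s => [|x s IHs] y z /=; first by rewrite !inE => /eqP-> /eqP->; rewrite joinxx.
rewrite !mem_cat => /orP[ys|/mapP[y' ys ->]] /orP[zs|/mapP[z' zs ->]].
- by rewrite IHs.
- by rewrite joinCA map_f ?orbT ?IHs.
- by rewrite -joinA map_f ?orbT ?IHs.
- by rewrite joinACA joinxx map_f ?orbT ?IHs.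
Qed.

Lemma finite_joins_ind s (P : B -> Prop) : P \bot -> (forall x, x \in s -> P x) ->
  (forall x y, P x -> P y -> P (x `|` y)) -> forall x, x \in finite_joins s -> P x.
Proof.
move=> P0 + PU; elim: s => [|x s IHs] /= Ps y; first by rewrite inE => /eqP->.
have {}IHs : forall z, z \in finite_joins s -> P z.
  by apply: IHs => z zs; apply: Ps; rewrite inE zs orbT.
rewrite mem_cat => /orP[/IHs //|/mapP[z /IHs Pz ->]].
by apply: PU => //; apply: Ps; rewrite mem_head.
Qed.

Lemma mul_finite_joins s : {in s &, forall x y, x * y \in finite_joins s} ->
  {in finite_joins s &, forall x y, x * y \in finite_joins s}.
Proof.
move=> mul_s x y xs ys; move: x xs; apply: finite_joins_ind => [|x xs|x x' xy x'y].
- by rewrite crl_mulC mulg0 bot_finite_joins.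
- move: y ys; apply: finite_joins_ind => [|y ys|y y' xy xy'].
  + by rewrite mulg0 bot_finite_joins.
  + exact: mul_s.
  + by rewrite mulgUr join_finite_joins.
- by rewrite crl_mulC mulgUr ![y * _]crl_mulC join_finite_joins.
Qed.

(** [undup] makes the size count distinct elements, which is the quantity to be minimised. *)
Definition generated c g : seq B :=
  undup [seq c * x | x <- finite_joins (monomials g)].

Lemma size_generated c g : (size (generated c g) <= 2 ^ k.+1 ^ size g)%N.
Proof.
rewrite (leq_trans (size_undup _)) //.
by rewrite size_map size_finite_joins size_monomials.
Qed.

Lemma mem_generated c g x : x \in finite_joins (monomials g) -> c * x \in generated c g.
Proof. by move=> xg; rewrite mem_undup map_f. Qed.

Lemma scale_generated c g x : (0 < k)%N -> x \in g -> c * x \in generated c g.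
Proof. by move=> k0 xg; rewrite mem_generated // sub_finite_joins // sub_monomials. Qed.

Lemma generated_frame c g : (0 < k)%N -> c * c = c ->
  (forall h : pt, Defs.zero h \in g) -> frame (generated c g) c.
Proof.
move=> k0 cc zg; split.
- by rewrite -[X in X \in _]mulg1 mem_generated // sub_finite_joins // one_monomials.
- by move=> x; rewrite mem_undup => /mapP[y _ ->]; rewrite mulgA cc.
- move=> x y; rewrite !mem_undup => /mapP[x' xg ->] /mapP[y' yg ->].
  rewrite crl_mulACA cc map_f // mul_finite_joins // => a b ag bg.
  by rewrite sub_finite_joins // mul_monomials.
- move=> x y; rewrite !mem_undup => /mapP[x' xg ->] /mapP[y' yg ->].
  by rewrite -mulgUr map_f // join_finite_joins.
- by rewrite -(mulg0 c) mem_generated // bot_finite_joins.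
- by move=> h; rewrite scale_generated.
Qed.

(** Since c' = c'c, the new set is the image of the old one under multiplication by c', and this map
    identifies [x] with [y]. *)
Lemma size_generated_lt c c' g x y : c' * c = c' ->
  x \in generated c g -> y \in generated c g -> x != y -> c' * x = c' * y ->
  (size (generated c' g) < size (generated c g))%N.
Proof.
move=> c'c xg yg xy c'xy.
have eq_gen : generated c' g =i undup [seq c' * z | z <- generated c g].
  move=> z; rewrite !mem_undup; apply/mapP/mapP => [[t tg ->]|[t + ->]].
    by exists (c * t); rewrite ?mem_generated // mulgA c'c.
  by rewrite mem_undup => /mapP[t' t'g ->]; exists t'; rewrite // mulgA c'c.
rewrite (perm_size (uniq_perm (undup_uniq _) (undup_uniq _) eq_gen)).
rewrite -[ltnRHS](size_map (mul c')) ltn_size_undup.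
(* If no element were lost, the map would be injective on positions, so the positions of [x] and [y]
   would coincide. *)
apply: contra xy => /(uniqP (c' * x)) inj.
rewrite -(nth_index x xg) -(nth_index x yg); apply/eqP; congr nth.
apply: inj; rewrite ?inE ?size_map ?index_mem //.
by rewrite !(nth_map x) ?index_mem // !nth_index.
Qed.

End Generation.

Fixpoint formula_size (pt : bool) (p : formula pt) : nat :=
  match p with
  | Mul q r | Imp q r | Meet q r | Join q r =>
      (formula_size q + formula_size r).+1
  | _ => 1
  end.

Lemma size_subvalues (k : nat) (pt : bool) (d : Order.disp_t)
    (B : kcirlType k pt d) (v : nat -> B) (p : formula pt) :
  size (subvalues v p) = formula_size p.
Proof.
by elim: p => //= q IHq r IHr; rewrite size_cat IHq IHr.
Qed.

(** The size bound counts one generator per subformula occurrence and one for the constant 0, then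
    exponents from 0 to [k], then sets of monomials. *)
Lemma exists_refutation (dA : Order.disp_t) (k : nat) (pt : bool)
    (d : Order.disp_t) (B : kcirlType k pt d) (v : nat -> B) (p : formula pt) :
  eval v p != 1 ->
  exists (A : finKcirlType k pt dA) (u : nat -> A),
    [/\ subdirectly_irreducible A, eval u p != 1,
        (#|A| <= 2 ^ k.+1 ^ (formula_size p).+1)%N &
        ~ valid B (refutation_formula u p)].
Proof.
move=> vp1; have k0 := k_gt0 vp1.
(* If 0 is not in the type, any element can stand in, so the number of generators is the same in
   both cases. *)
have [z zE] : exists z : B, forall h : pt, Defs.zero h = z.
  have [h|nh] := pselect pt; last by exists 1 => h; case: nh.
  by exists (Defs.zero h) => h'; rewrite (bool_irrelevance h' h).
pose g := z :: subvalues v p.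
pose refuting_size n := exists c : B,
  [/\ c * c = c, ~~ (c <= eval v p) & size (generated c g) = n].
have : exists n, `[< refuting_size n >].
  exists (size (generated 1 g)); apply/asboolP; exists 1; split=> //.
    by rewrite mulg1.
  by apply: contra vp1 => vp1; rewrite eq_le lex1g.
case/ex_minnP => _ /asboolP[c [cc cp <-]] c_min.
have zg h : Defs.zero h \in g by rewrite (zE h) mem_head.
have Fs := generated_frame k0 cc zg.
have vs x : x \in subvalues v p -> c * x \in generated c g.
  by move=> xs; rewrite scale_generated // inE xs orbT.
have cnle : ~~ (c <= \join_(ab : frame_algebra dA Fs * frame_algebra dA Fs
    | ~~ (ab.1 <= ab.2)) imp (frame_val ab.1) (frame_val ab.2)).
  apply: contra cp => /(idem_le_joins k0 cc); apply=> -[a b] /= ab.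
  set t := imp _ _; pose c' := c * t ^+ k; rewrite -/c'; apply: contraT => c'p.
  have c'c : c' * c = c' by rewrite crl_mulC mulgA cc.
  have c'c' : c' * c' = c'.
    by rewrite crl_mulACA cc expgk_idem.
  have /c_min : `[< refuting_size (size (generated c' g)) >].
    by apply/asboolP; exists c'.
  (* As c' is below a -> b, it forces [a] below [b] only in the quotient: it merges a \/ b with [b],
     which are distinct because [a] is not below [b]. *)
  rewrite leqNgt; rewrite (@size_generated_lt _ _ _ _ c _ g
    (frame_val (a `|` b)) (frame_val b)) //.
  - exact: fval_mem.
  - exact: fval_mem.
  - by apply: contraNN ab => /eqP/fval_inj <-; rewrite leUl.
  rewrite fval_join mulgUr; apply/join_r.
  rewrite -{1}c'c' -mulgA mul_le2l // crl_mulC -le_imp.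
  by rewrite (le_trans (mul_ler _ _)) // expg_lex.
exists (frame_algebra dA Fs), (frame_valuation dA Fs v); split.
- exact: frame_subdirectly_irreducible cnle.
- apply: contraNneq cp => up1.
  have c_eval : c = c * eval v p by rewrite -(fval_eval dA Fs vs) up1.
  by rewrite c_eval mul_ler.
- rewrite card_seq_sub ?undup_uniq //.
  by rewrite -(size_subvalues v) (size_generated c g).
- exact: refutation_formula_invalid.
Qed.

(** * Finitely many canonical formulas *)

Local Open Scope classical_set_scope.

Section FiniteFormulas.
Variable pt : bool.
Implicit Types (p q : formula pt) (N D : nat).

Fixpoint bounded N D p {struct p} : bool :=
  match p, D with
  | Var n, _ => (n < N)%N
  | One, _ | Bot, _ | Zero _, _ => true
  | Mul q r, D'.+1 | Imp q r, D'.+1 | Meet q r, D'.+1 | Join q r, D'.+1 =>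
      bounded N D' q && bounded N D' r
  | _, _ => false
  end.

Lemma bounded_leq N D D' p : (D <= D')%N -> bounded N D p -> bounded N D' p.
Proof.
elim: p D D' => [n|||h|q IHq r IHr|q IHq r IHr|q IHq r IHr|q IHq r IHr]
  [|D] [|D'] //= DD' /andP[qD rD];
  by apply/andP; split; [apply: IHq qD | apply: IHr rD].
Qed.

Lemma finite_bounded N D : finite_set [set p | bounded N D p].
Proof.
elim: D => [|D IHD].
  pose atoms : set (formula pt) :=
    [set Var n | n in `I_N] `|` [set One; Bot] `|` range Zero.
  apply: (@sub_finite_set _ _ atoms).
    case=> //= [n nN|_|_|h _]; last by right; exists h.
    - by left; left; exists n.
    - by left; right; left.
    - by left; right; right.
  rewrite /atoms !finite_setU; split; first split.
  - exact/finite_image/finite_II.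
  - by split; apply: finite_set1.
  (* There is at most one formula [Zero h], by irrelevance of proofs of a boolean. *)
  have [h|nh] := pselect pt.
    apply: (sub_finite_set _ (finite_set1 (Zero h))) => _ [h' _ <-] /=.
    by rewrite (bool_irrelevance h' h).
  by apply: (sub_finite_set _ (finite_set0 _)) => p [h]; case: nh.
pose S := [set p | bounded N D p].
pose image op : set (formula pt) := [set op q r | q in S & r in S].
apply: (@sub_finite_set _ _ (S `|` (image (@Mul pt) `|` image (@Imp pt) `|`
  (image (@Meet pt) `|` image (@Join pt))))).
  case=> /= [n nN|_|_|h _|q r|q r|q r|q r];
    try by left.
  - by move=> /andP[qS rS]; right; left; left; exists q => //; exists r.
  - by move=> /andP[qS rS]; right; left; right; exists q => //; exists r.
  - by move=> /andP[qS rS]; right; right; left; exists q => //; exists r.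
  - by move=> /andP[qS rS]; right; right; right; exists q => //; exists r.
rewrite !finite_setU; split; first exact: IHD.
by split; split; apply: finite_image2.
Qed.

Lemma bounded_bigMeet N D (s : seq (formula pt)) :
  all (bounded N D) s -> bounded N (size s + D) (bigMeet s).
Proof.
elim: s => //= p s IHs /andP[pD /IHs ->]; rewrite andbT.
exact: bounded_leq (leq_addl _ _) pD.
Qed.

Lemma bounded_bigJoin N D (s : seq (formula pt)) :
  all (bounded N D) s -> bounded N (size s + D) (bigJoin s).
Proof.
elim: s => //= p s IHs /andP[pD /IHs ->]; rewrite andbT.
exact: bounded_leq (leq_addl _ _) pD.
Qed.

Lemma bounded_Pow N D p n : bounded N D p -> bounded N (n + D) (Pow p n).
Proof.
case: n => // n pD; elim: n => [|n IHn]; first exact: bounded_leq pD.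
by apply/andP; split; [apply: bounded_leq (leq_addl n.+1 D) pD | apply: IHn].
Qed.

End FiniteFormulas.

(** [Gamma] has at most 3 clauses for bottom, 1 and 0, and four families of at most [N ^ 2] clauses,
    each clause of depth at most 3. The power adds [k] and the outer implication 1. *)
Lemma bounded_canonical_formula (k : nat) (pt : bool) (d : Order.disp_t)
    (A : finKcirlType k pt d) (Dmeet Dimp : {set A * A}) (N : nat) :
  (#|A| <= N)%N ->
  bounded N (k + (N ^ 2 * 4 + 6)).+1 (canonical_formula Dmeet Dimp).
Proof.
move=> AN.
have XN (a : A) : (enum_rank a < N)%N := leq_trans (ltn_ord _) AN.
have card_pairs (D : {set A * A}) : (#|D| <= N ^ 2)%N.
  by rewrite (leq_trans (max_card _)) // card_prod -mulnn leq_mul.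
rewrite /canonical_formula; apply/andP; split.
  apply/bounded_Pow; rewrite /Gamma; set s := (X in bigMeet X).
  apply: (@bounded_leq _ _ (size s + 3)); last first.
    apply: bounded_bigMeet; rewrite /s /= !all_cat !all_map /= !XN /=.
    apply/and5P; split.
    - by apply/all_zero_clause => h /=; rewrite !XN.
    - by apply/all_allpairsP => a b _ _ /=; rewrite !XN.
    - by apply/all_allpairsP => a b _ _ /=; rewrite !XN.
    - by apply/allP => -[a b] _ /=; rewrite !XN.
    - by apply/allP => -[a b] _ /=; rewrite !XN.
  have zero_size : (size (zero_clause A) <= 1)%N.
    suff size_reflect b (r : reflect pt b) (F : pt -> formula pt) :
        (size (match r with ReflectT h => [:: F h] | ReflectF _ => [::] end)
          <= 1)%N.
      exact: size_reflect.
    by case: r.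
  rewrite /s !size_cat !size_allpairs !size_map [size [:: _; _]]/=.
  rewrite -!cardE -?enumT -?cardE.
  have := card_pairs Dmeet; have := card_pairs Dimp.
  have := leq_mul AN AN; rewrite !mulnn; move: zero_size.
  move: (N ^ 2)%N (#|A| ^ 2)%N #|Dimp| #|Dmeet| (size _) => M a i m z. lia.
change (bounded N (k + (N ^ 2 * 4 + 6)) (Delta A)).
apply: (@bounded_leq _ _ (N ^ 2 + 1)); first lia.
apply: (@bounded_leq _ _ (size [seq ab <- enum {: A * A} | ~~ (ab.1 <= ab.2)] + 1)).
  rewrite leq_add2r -mulnn size_filter (leq_trans (count_size _ _)) //.
  by rewrite -cardE card_prod leq_mul.
rewrite -(size_map (fun ab : A * A => Imp (X ab.1) (X ab.2))).
apply: bounded_bigJoin; rewrite all_map; apply/allP => -[a b] _ /=.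
by rewrite !XN.
Qed.

Local Open Scope quotient_scope.

(** * Lindenbaum algebra *)

(** Classical instances: the quotient by interderivability requires a choice type. *)
HB.instance Definition _ (pt : bool) := gen_eqMixin (formula pt).
HB.instance Definition _ (pt : bool) := gen_choiceMixin (formula pt).

Section Lindenbaum.
Variables (k : nat) (pt : bool).
Implicit Types (p q r : formula pt).

Definition entails p q : bool := `[< FLew k [:: p] q >].

Lemma FLew_cut1 G p q : FLew k G p -> FLew k [:: p] q -> FLew k G q.
Proof. by move=> Gp pq; rewrite -[G]cats0; apply: FL_cut pq. Qed.

Lemma entails_refl p : entails p p.
Proof. exact/asboolP/FL_id. Qed.

Lemma entails_trans q p r : entails p q -> entails q r -> entails p r.
Proof. by move=> /asboolP pq /asboolP qr; apply/asboolP; apply: FLew_cut1 pq qr. Qed.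

Lemma entails_mul p p' q q' :
  entails p p' -> entails q q' -> entails (Mul p q) (Mul p' q').
Proof.
move=> /asboolP pp' /asboolP qq'; apply/asboolP/FL_MulL.
exact: (FL_MulR (G := [:: p])).
Qed.

Lemma entails_mulC p q : entails (Mul p q) (Mul q p).
Proof.
apply/asboolP/FL_MulL/(FL_exchange (G := [::])).
by apply: (FL_MulR (G := [:: q])); apply: FL_id.
Qed.

Lemma entails_mulA p q r : entails (Mul (Mul p q) r) (Mul p (Mul q r)).
Proof.
apply/asboolP/FL_MulL/FL_MulL/(FL_MulR (G := [:: p])); first exact: FL_id.
by apply: (FL_MulR (G := [:: q])); apply: FL_id.
Qed.

Lemma entails_mul1 p : entails (Mul One p) p.
Proof. exact/asboolP/FL_MulL/FL_OneL/FL_id. Qed.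

Lemma entails_1mul p : entails p (Mul One p).
Proof. by apply/asboolP/(FL_MulR (G := [::])); [apply: FL_OneR | apply: FL_id]. Qed.

Lemma entails_imp p q r : entails q (Imp p r) = entails (Mul p q) r.
Proof.
apply/idP/idP => /asboolP H; apply/asboolP.
  apply/FL_MulL/(FL_exchange (G := [::])).
  apply: (FL_cut (G := [:: q]) H); apply: (FL_ImpL (G := [:: p])); exact: FL_id.
apply: FL_ImpR; apply: FLew_cut1 _ H.
by apply: (FL_MulR (G := [:: p])); apply: FL_id.
Qed.

Lemma entails_meet p q r : entails r (Meet p q) = entails r p && entails r q.
Proof.
apply/idP/andP => [rpq|[/asboolP rp /asboolP rq]]; last exact/asboolP/FL_MeetR.
split; apply: entails_trans rpq _; apply/asboolP.
  exact/FL_MeetL1/FL_id.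
exact/FL_MeetL2/FL_id.
Qed.

Lemma entails_join p q r : entails (Join p q) r = entails p r && entails q r.
Proof.
apply/idP/andP => [pqr|[/asboolP pr /asboolP qr]]; last exact/asboolP/FL_JoinL.
split; apply: entails_trans pqr; apply/asboolP.
  exact/FL_JoinR1/FL_id.
exact/FL_JoinR2/FL_id.
Qed.

Lemma entails_bot p : entails Bot p.
Proof. exact/asboolP/FL_BotL. Qed.

Lemma entails_one p : entails p One.
Proof. exact/asboolP/FL_weakening/FL_OneR. Qed.

Lemma one_entails p : entails One p -> FLew_provable k p.
Proof. by move=> /asboolP; apply: FLew_cut1 (@FL_OneR pt k). Qed.

Lemma entails_kpotent p :
  entails (Pow p k) (Pow p k.+1) && entails (Pow p k.+1) (Pow p k).
Proof.
have imp_entails q r : entails One (Imp q r) -> entails q r.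
  rewrite entails_imp => /(entails_trans (entails_mulC _ _)).
  exact/entails_trans/entails_1mul.
have := FL_weakening One (FL_kpotency k p).
move=> /asboolP; rewrite -/(entails _ _) entails_meet.
by move=> /andP[/imp_entails -> /imp_entails ->].
Qed.

Definition interderivable p q := entails p q && entails q p.

Fact interderivable_refl : reflexive interderivable.
Proof. by move=> p; rewrite /interderivable entails_refl. Qed.

Fact interderivable_sym : symmetric interderivable.
Proof. by move=> p q; rewrite /interderivable andbC. Qed.

Fact interderivable_trans : transitive interderivable.
Proof.
move=> q p r /andP[pq qp] /andP[qr rq].
by rewrite /interderivable (entails_trans pq qr) (entails_trans rq qp).
Qed.

Canonical interderivable_equiv := EquivRel interderivable
  interderivable_refl interderivable_sym interderivable_trans.

Definition lindenbaum := {eq_quot interderivable}.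
HB.instance Definition _ := Choice.on lindenbaum.
Implicit Types x y z : lindenbaum.

Definition rep x : formula pt := repr x.
Definition lclass p : lindenbaum := \pi_{eq_quot interderivable} p.

Lemma repK x : lclass (rep x) = x.
Proof. exact: reprK. Qed.

Lemma lclass_eq p q : (lclass p == lclass q) = interderivable p q.
Proof. exact: eqmodE. Qed.

Lemma rep_lclass p : interderivable (rep (lclass p)) p.
Proof. by rewrite -lclass_eq repK. Qed.

Lemma entails_repl p q : entails (rep (lclass p)) q = entails p q.
Proof.
by have /andP[pp' p'p] := rep_lclass p; apply/idP/idP; apply: entails_trans.
Qed.

Lemma entails_repr p q : entails q (rep (lclass p)) = entails q p.
Proof.
by have /andP[pp' p'p] := rep_lclass p; apply/idP/idP => /entails_trans; apply.
Qed.

Definition lle x y := entails (rep x) (rep y).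

Fact lle_refl : reflexive lle.
Proof. by move=> x; apply: entails_refl. Qed.

Fact lle_anti : antisymmetric lle.
Proof. by move=> x y xy; apply/eqP; rewrite -(repK x) -(repK y) lclass_eq. Qed.

Fact lle_trans : transitive lle.
Proof. by move=> y x z; apply: entails_trans. Qed.

Definition ldisp : Order.disp_t := Order.Disp tt tt.

HB.instance Definition _ :=
  Order.Le_isPOrder.Build ldisp lindenbaum lle_refl lle_anti lle_trans.

Lemma le_rep x y : (x <= y) = entails (rep x) (rep y).
Proof. by []. Qed.

Lemma lclass_le p q : (lclass p <= lclass q) = entails p q.
Proof. by rewrite le_rep entails_repl entails_repr. Qed.

Definition lmul x y := lclass (Mul (rep x) (rep y)).
Definition limp x y := lclass (Imp (rep x) (rep y)).
Definition lmeet x y := lclass (Meet (rep x) (rep y)).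
Definition ljoin x y := lclass (Join (rep x) (rep y)).

Fact lmeetP x y z : (x <= lmeet y z) = (x <= y) && (x <= z).
Proof. by rewrite !le_rep entails_repr entails_meet. Qed.

Fact ljoinP x y z : (ljoin x y <= z) = (x <= z) && (y <= z).
Proof. by rewrite !le_rep entails_repl entails_join. Qed.

HB.instance Definition _ :=
  Order.POrder_MeetJoin_isLattice.Build ldisp lindenbaum lmeetP ljoinP.

Lemma lmul_class p q : lmul (lclass p) (lclass q) = lclass (Mul p q).
Proof.
have /andP[pp' p'p] := rep_lclass p; have /andP[qq' q'q] := rep_lclass q.
by apply/eqP; rewrite lclass_eq /interderivable !entails_mul.
Qed.

Fact lmulC x y : lmul x y = lmul y x.
Proof. by apply/eqP; rewrite lclass_eq /interderivable !entails_mulC. Qed.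

Fact lmulA : associative lmul.
Proof.
have mulA_le x y z : lmul (lmul x y) z <= lmul x (lmul y z).
  rewrite -(repK x) -(repK y) -(repK z) !lmul_class lclass_le.
  exact: entails_mulA.
move=> x y z; apply: le_anti; rewrite mulA_le andbT.
by rewrite lmulC (lmulC y) (lmulC (lmul _ _) z) (lmulC x) mulA_le.
Qed.

Fact lmul1 : left_id (lclass One) lmul.
Proof.
move=> x; rewrite -(repK x) lmul_class; apply/eqP.
by rewrite lclass_eq /interderivable entails_mul1 entails_1mul.
Qed.

Fact lmulx1 : right_id (lclass One) lmul.
Proof. by move=> x; rewrite lmulC lmul1. Qed.

HB.instance Definition _ := isMonoid.Build lindenbaum lmulA lmul1 lmulx1.

Fact lresiduation x y z : x * y <= z <-> y <= limp x z.
Proof. by rewrite !le_rep entails_repl entails_repr entails_imp. Qed.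

HB.instance Definition _ := isCRL.Build pt ldisp lindenbaum
  (fun h => lclass (Zero h)) lmulC lresiduation.

Fact lbot_le x : lclass Bot <= x.
Proof. by rewrite le_rep entails_repl entails_bot. Qed.

Fact le_lone x : x <= 1.
Proof. by rewrite le_rep entails_repr entails_one. Qed.

HB.instance Definition _ := Order.hasBottom.Build ldisp lindenbaum lbot_le.
HB.instance Definition _ := Order.hasTop.Build ldisp lindenbaum le_lone.
HB.instance Definition _ := isIntegral.Build pt ldisp lindenbaum erefl.

Lemma lclass_Pow p n : lclass (Pow p n) = lclass p ^+ n.
Proof.
case: n => // n; elim: n => // n IHn.
by rewrite expgS -IHn -[_ * _]/(lmul _ _) lmul_class.
Qed.

Fact lkpotent x : x ^+ k = x ^+ k.+1.
Proof.
apply/eqP; rewrite -(repK x) -!lclass_Pow lclass_eq.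
exact: entails_kpotent.
Qed.

HB.instance Definition _ := isKPotent.Build k pt ldisp lindenbaum lkpotent.

Lemma eval_lindenbaum p : eval (fun n => lclass (Var n) : lindenbaum) p = lclass p.
Proof.
elim: p => [n|||h|q IHq r IHr|q IHq r IHr|q IHq r IHr|q IHq r IHr] //=;
  rewrite IHq IHr.
- exact: lmul_class.
(* Unlike the product, the residual, meet and join are determined by the order, so their
   compatibility with classes follows from their universal properties. *)
- apply: le_anti; apply/andP; split.
    rewrite -[X in X <= _]repK lclass_le entails_imp -lclass_le -lmul_class repK.
    exact: mul_imp_le.
  rewrite le_imp -[_ * _]/(lmul _ _) lmul_class lclass_le -entails_imp.
  exact: entails_refl.
- apply: le_anti; apply/andP; split.
    rewrite -[X in X <= _]repK lclass_le entails_meet -!lclass_le repK.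
    by rewrite leIl leIr.
  by rewrite lexI !lclass_le -entails_meet entails_refl.
- apply: le_anti; apply/andP; split.
    by rewrite leUx !lclass_le -entails_join entails_refl.
  rewrite -[X in _ <= X]repK lclass_le entails_join -!lclass_le repK.
  by rewrite leUl leUr.
Qed.

(** Under the canonical valuation [p] evaluates to its own class, and a class equal to 1 means that
    [One] entails [p]. *)
Lemma FLew_complete p :
  (forall (d : Order.disp_t) (B : kcirlType k pt d), valid B p) ->
  FLew_provable k p.
Proof.
move=> /(_ ldisp lindenbaum (fun n => lclass (Var n))).
by rewrite eval_lindenbaum => p1; apply: one_entails; rewrite -lclass_le p1.
Qed.

End Lindenbaum.

Theorem theorem3p4 (k : nat) (pt : bool) (d : Order.disp_t) (phi : formula pt) :
  ~ FLew_provable k phi ->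
  exists (m : nat) (A : 'I_m.+1 -> finKcirlType k pt d)
         (Dmeet Dimp : forall i : 'I_m.+1, {set A i * A i}),
    (forall i : 'I_m.+1, subdirectly_irreducible (A i)) /\
    forall (d' : Order.disp_t) (B : kcirlType k pt d'),
      valid B phi <->
      (forall i : 'I_m.+1, valid B (canonical_formula (Dmeet i) (Dimp i))).
Proof.
move=> nphi; set N := (2 ^ k.+1 ^ (formula_size phi).+1)%N.
pose triple := {A : finKcirlType k pt d & ({set A * A} * {set A * A})%type}.
pose gamma (t : triple) := canonical_formula (projT2 t).1 (projT2 t).2.
(* Finiteness is sought for the formulas and not for the triples, since algebras of bounded size
   still live on arbitrary carriers. The last condition builds in the forward direction of the
   equivalence. *)
pose good (psi : formula pt) (t : triple) :=
  [/\ gamma t = psi, subdirectly_irreducible (projT1 t),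
      (#|projT1 t| <= N)%N &
      forall d' (B : kcirlType k pt d'), valid B phi -> valid B psi].
have good_refutation d' (B : kcirlType k pt d') : ~ valid B phi ->
    exists psi, (exists t, good psi t) /\ ~ valid B psi.
  move=> /existsNP[v /eqP/(exists_refutation d)[A [u [Asi uphi AN Bpsi]]]].
  exists (refutation_formula u phi); split=> //.
  exists (existT _ A ([set ab in meet_pairs u phi], [set ab in imp_pairs u phi])).
  by split=> // d'' C; apply: valid_refutation_formula.
have : finite_set [set psi | exists t, good psi t].
  apply: (sub_finite_set _ (finite_bounded pt N (k + (N ^ 2 * 4 + 6)).+1)).
  by move=> _ [t [<- _ tN _]]; apply: bounded_canonical_formula.
move=> /finite_seqP[s sE].
have goodP psi : psi \in s <-> exists t, good psi t.
  by have := congr1 (fun S : set (formula pt) => S psi) sE => /= ->.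
(* The index type ['I_m.+1] requires a nonempty list; completeness provides an algebra refuting phi,
   hence a good formula. *)
have s_gt0 : (0 < size s)%N.
  have [d0 [B nB]] :
      exists (d0 : Order.disp_t) (B : kcirlType k pt d0), ~ valid B phi.
    apply: contrapT => noB; apply/nphi/FLew_complete => d0 B.
    by apply: contrapT => nB; apply: noB; exists d0, B.
  have [psi [/goodP psis _]] := good_refutation _ _ nB.
  by case: (s) psis.
(* One algebra with its sets of pairs is chosen for each of the finitely many formulas. *)
have /choice[t tP] : forall i : 'I_(size s).-1.+1, exists t, good (nth One s i) t.
  by move=> i; apply/goodP; rewrite mem_nth // -[X in (_ < X)%N](prednK s_gt0).
exists (size s).-1, (fun i => projT1 (t i)), (fun i => (projT2 (t i)).1),
  (fun i => (projT2 (t i)).2); split=> [i|d' B]; first by case: (tP i).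
split=> [Bphi i|Bgamma].
  by have [<- _ _] := tP i => H; apply: H.
apply: contrapT => /good_refutation[psi [/goodP psis]]; apply.
have psi_lt : (index psi s < (size s).-1.+1)%N by rewrite prednK // index_mem.
have [+ _ _ _] := tP (Ordinal psi_lt).
by rewrite /= nth_index // => <-; apply: Bgamma.
Qed.
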